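(* Let $X$ be a hereditarily paracompact, scattered space. Then the box product $\square X^\omega$ and the nabla product $\nabla X^\omega$ are both hereditarily $D$.
   Context: Paracompact spaces are understood to be Hausdorff; a space is hereditarily paracompact if all its subspaces are paracompact. A space is scattered if every nonempty subspace has an isolated point (in the subspace). A neighbornet on a space $(X,\tau)$ is a map $U:X\to\tau$ with $x\in U(x)$ for all $x\in X$. $X$ is a $D$-space if for every neighbornet $U$ on $X$ there is a closed discrete $D\subseteq X$ with $\bigcup_{x\in D}U(x)=X$. A space is hereditarily $D$ if each of its subspaces is a $D$-space. $\square X^\omega$ is the set $X^\omega$ with the topology generated by all sets $\prod_{n\in\omega} U_n$ with every $U_n$ open in $X$. $\nabla X^\omega$ is the quotient space $(\square X^\omega)/{=^*}$, where $x=^*y$ iff $x(n)=y(n)$ for all but finitely many $n$. *)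

(* Defs.v *)
From HB Require Import structures.
From mathcomp Require Import all_boot all_classical.
From mathcomp Require Import topology.

Set Implicit Arguments.
Unset Strict Implicit.
Unset Printing Implicit Defensive.

Local Open Scope classical_set_scope.

(* The canonical topology of [set_type A] is
   the one induced by X (initial topology of the inclusion). *)
Definition hereditarily (P : topologicalType -> Prop) (X : topologicalType) :=
  forall A : set X, P (set_type A).

Section Covers.
Variable X : topologicalType.
Implicit Types U V : set (set X).

Definition open_cover U := U `<=` open /\ \bigcup_(A in U) A = [set: X].

Definition refines V U := forall B, V B -> exists2 A, U A & B `<=` A.

Definition locally_finite V := forall x : X,
  exists2 W, nbhs x W & finite_set [set B | V B /\ B `&` W !=set0].

End Covers.

Definition paracompact (X : topologicalType) :=
  hausdorff_space X /\
  forall U : set (set X), open_cover U ->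
    exists V, [/\ open_cover V, refines V U & locally_finite V].

Definition scattered (X : topologicalType) :=
  forall A : set X, A !=set0 -> isolated A !=set0.

Definition neighbornet (X : topologicalType) (U : X -> set X) :=
  forall x, open (U x) /\ U x x.

Definition discrete_subset (X : topologicalType) (D : set X) :=
  forall B : set (set_type D), open B.

Definition D_space (X : topologicalType) :=
  forall U : X -> set X, neighbornet U ->
    exists D : set X,
      [/\ closed D, discrete_subset D & \bigcup_(x in D) U x = [set: X]].

(* An alias is needed: [nat -> X] itself carries the Tychonoff topology. *)
Definition box_product (X : Type) : Type := nat -> X.

Section BoxTopology.
Variable X : topologicalType.

Definition open_box (U : nat -> set X) : set (box_product X) :=
  [set x | forall n, U n (x n)].

Lemma open_box_cover :
  \bigcup_(U in [set U : nat -> set X | forall n, open (U n)]) open_box U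
  = setT.
Proof.
apply/seteqP; split => // x _.
by exists (fun=> setT) => // n; exact: openT.
Qed.

Lemma open_box_join (U V : nat -> set X) (x : box_product X) :
  (forall n, open (U n)) -> (forall n, open (V n)) ->
  open_box U x -> open_box V x ->
  exists W : nat -> set X, [/\ forall n, open (W n), open_box W x &
    open_box W `<=` open_box U `&` open_box V].
Proof.
move=> oU oV Ux Vx; exists (fun n => U n `&` V n); split.
- by move=> n; exact: openI.
- by move=> n; split; [exact: Ux|exact: Vx].
- by move=> y Wy; split=> n; have [] := Wy n.
Qed.

HB.instance Definition _ := Choice.copy (box_product X) (nat -> X).
HB.instance Definition _ :=
  isBaseTopological.Build (box_product X) open_box_cover open_box_join.

End BoxTopology.

Section Nabla.
Variable X : topologicalType.

Definition eqstar (x y : box_product X) : bool :=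
  `[< finite_set [set n | x n <> y n] >].

Lemma eqstar_refl : reflexive eqstar.
Proof.
move=> x; apply/asboolP; rewrite (_ : [set _ | _] = set0)//.
by apply/seteqP; split => // n /=.
Qed.

Lemma eqstar_sym : symmetric eqstar.
Proof.
by move=> x y; rewrite /eqstar; congr (`[< finite_set _ >]);
  apply/seteqP; split => n /= /nesym.
Qed.

Lemma eqstar_trans : transitive eqstar.
Proof.
move=> y x z /asboolP xy /asboolP yz; apply/asboolP.
apply: (@sub_finite_set _ _ ([set n | x n <> y n] `|` [set n | y n <> z n])).
  move=> n /= xz; have [xyn|] := pselect (x n = y n); last by left.
  by right=> yzn; apply: xz; rewrite xyn.
by rewrite finite_setU.
Qed.

Canonical eqstar_equiv := EquivRel eqstar eqstar_refl eqstar_sym eqstar_trans.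

Definition nabla_product : topologicalType :=
  quotient_topology {eq_quot eqstar_equiv}%qT.

End Nabla.

(* Main.v *)
Require Import Defs.
From mathcomp Require Import all_boot all_classical.
From mathcomp Require Import topology wochoice.

Set Implicit Arguments.
Unset Strict Implicit.
Unset Printing Implicit Defensive.

Local Open Scope classical_set_scope.

(** The proof transports an order on [X] to the two products.

    A scattered hereditarily paracompact space [X] carries a preorder whose
    up-sets [{y | x <= y}] are open and whose down-sets [{x | x <= y}] are
    finite ([scattered_point_finite_order]).  Scatteredness allows such an
    order to be built upwards: when an open set [G] has one and [p] is isolated
    outside [G], putting [p] below everything orders [G] with [p] added.
    Orders on the members of an open family are glued along a point-finite
    open refinement, comparing [x] with [y] only if every chosen
    neighbourhood of [x] agrees; hence the union of all orderable open sets is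
    orderable, and it must be all of [X].

    Order the products coordinatewise: everywhere for the box product, at all
    but finitely many coordinates for the nabla product.  Up-sets are boxes, in
    the second case up to finitely many coordinates, hence open.  The
    down-set of [x] is infinite in general, but it comes from a box of finite
    sets; as finite subsets of [X] are closed and discrete, the
    down-set is closed and discrete in both products
    ([box_closed_discrete_order], [nabla_closed_discrete_order]).

    Finally, any space preordered with open up-sets and closed discrete
    down-sets is a D-space ([closed_discrete_order_D]), and such a preorder
    restricts to subspaces.  Given a neighbornet [V], enumerate the space by a
    well-order as [x_0, x_1, ...] and at each stage add to [D] all points below
    [x_a] not yet covered by [V].  What is added at one stage is closed
    and discrete.  Points added later avoid the open set [V d] of a
    point [d] chosen before them.  A point [z] covered for the first time at
    stage [a] has an up-set that avoids every earlier choice: if [z <= d] with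
    [d] chosen earlier, then [z] itself would have been chosen at that earlier
    stage. *)

(** * Well-founded recursion *)

(** The well-ordering principle, with the order made strict so that
    well-founded recursion applies to it. *)
Lemma strict_well_order (T : choiceType) :
  exists lt : T -> T -> Prop,
    [/\ well_founded lt, forall a b c, lt a b -> lt b c -> lt a c
      & forall a b, [\/ lt a b, a = b | lt b a]].
Proof.
have [R woR] := well_ordering_principle T.
have woT : wo_chain R predT by move=> A _; exact: woR.
have tot a b : R a b || R b a by exact: (wo_chainW woT).
have anti a b : R a b -> R b a -> a = b.
  by move=> ab ba; apply: (wo_chain_antisymmetric woT) => //; rewrite ab ba.
exists (fun a b => ~~ R b a); split.
- move=> a; apply: contrapT => nAcc.
  have [|z [[zP zmin] _]] :=
    woR [pred x | `[< ~ Acc (fun a b => ~~ R b a) x >]].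
    by exists a; rewrite inE.
  move: zP; rewrite inE; apply; constructor=> y; apply: contraNP.
  by move=> nAy; apply: zmin; rewrite inE.
- move=> a b c ab bc; apply/negP => ca.
  (* [c] would be below [a]: the least of [a], [b], [c] is none of them. *)
  have [|z [[zP zmin] _]] := woR [pred x | x \in [:: a; b; c]].
    by exists a; rewrite !inE eqxx.
  have [za zb zc] : [/\ R z a, R z b & R z c].
    by split; apply: zmin; rewrite !inE eqxx ?orbT.
  move: zP; rewrite !inE => /or3P[] /eqP ez; move: za zb zc; rewrite ez.
  + move=> _ _ ac; move: ab bc; rewrite (anti _ _ ac ca).
    by have /orP[->|->] := tot b c.
  + by move=> ba; rewrite ba in ab.
  + by move=> _ cb; rewrite cb in bc.
- move=> a b; have [ab|nab] := boolP (R a b); last by constructor 3.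
  have [ba|nba] := boolP (R b a); last by constructor 1.
  by constructor 2; exact: anti.
Qed.

(** The equivalence is a recursive definition of [D], solved in [Prop]; it
    describes the outcome of a greedy choice in which earlier choices can block
    later ones. *)
Lemma wf_kernel (T : Type) (lt Q : T -> T -> Prop) : well_founded lt ->
  exists D : set T, forall d, D d <-> (forall e, lt e d -> D e -> ~ Q e d).
Proof.
move=> wf.
pose F d (D : forall e, lt e d -> Prop) :=
  forall e (h : lt e d), D e h -> ~ Q e d.
exists (Fix wf (fun=> Prop) F) => d; rewrite [X in X <-> _]Fix_eq //.
move=> {}d f g fg; rewrite /F; apply/propext; split=> H e h.
  by rewrite -fg; exact: H.
by rewrite fg; exact: H.
Qed.

(** * Orders with closed discrete down-sets and D-spaces *)

(** The last condition says that down-sets are closed and discrete, in the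
    form of a neighbourhood of each point of the space meeting the down-set
    at most at that point. *)
Definition closed_discrete_order (Y : topologicalType) (r : Y -> Y -> Prop) :=
  [/\ forall x, r x x, forall x y z, r x y -> r y z -> r x z,
      forall x, open [set y | r x y] &
      forall x z, exists2 N, open N &
        N z /\ N `&` [set y | r y x] `<=` [set z]].

Lemma closed_discrete_separated (Y : topologicalType) (D : set Y) :
  (forall z, exists2 N, open N & N z /\ N `&` D `<=` [set z]) ->
  closed D /\ discrete_subset D.
Proof.
move=> sep; split.
  rewrite -openC openE => z nDz; have [N oN [Nz ND]] := sep z.
  rewrite /interior nbhsE; exists N; first by split.
  by move=> y Ny Dy; have yz := ND y (conj Ny Dy); apply: nDz; rewrite -yz.
have {}sep z : {N | [/\ open N, N z & N `&` D `<=` [set z]]}.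
  by apply: cid; have [N oN [Nz ND]] := sep z; exists N.
move=> B; exists (\bigcup_(z in B) sval (sep (val z))).
  by apply: bigcup_open => z _; case: (svalP (sep (val z))).
apply/seteqP; split=> [y [z Bz]|y By]; last first.
  by exists y => //; case: (svalP (sep (val y))).
case: (svalP (sep (val z))) => _ _ sub Ny.
have /val_inj -> // : val y = val z.
by apply: sub; split=> //; exact: (set_valP y).
Qed.

(** The stagewise choice of [D] needs no transfinite enumeration: a point [d] is
    a candidate for the first time at stage [rho d], the [lt]-least point above
    [d], and if it is not selected then it is already covered and never will be.
    So membership of [d] in [D] depends only on the points of smaller [rho]. *)
Lemma closed_discrete_order_D (Y : topologicalType) (r : Y -> Y -> Prop) :
  closed_discrete_order r -> D_space Y.
Proof.
move=> [rxx rT oup sep] V nV.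
have [lt [wf ltT ltE]] := strict_well_order Y.
have ltxx x : ~ lt x x.
  by elim/(well_founded_ind wf): x => x IH h; exact: (IH x).
have rank_ex z : exists x, r z x /\ forall y, r z y -> ~ lt y x.
  have := rxx z; move: {2}z; elim/(well_founded_ind wf) => x IH zx.
  have [[y [zy yx]]|H] := pselect (exists y, r z y /\ lt y x).
    exact: IH yx zy.
  by exists x; split=> // y zy yx; apply: H; exists y.
have [rho rhoP] := choice rank_ex.
have rho_wf : well_founded (fun d e => lt (rho d) (rho e)).
  move=> d; move ex: (rho d) => x.
  elim/(well_founded_ind wf): x d ex => x IH d ex.
  by constructor=> e; rewrite ex => ed; exact: IH ed _ erefl.
have [D DP] := wf_kernel (fun e d => V e d) rho_wf.
(* One of the selected points whose neighbourhood covers [z] has least rank. *)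
have first_cover z : exists e, [/\ D e, V e z &
    forall d, D d -> V d z -> ~ lt (rho d) (rho e)].
  have [e De Ve] : exists2 e, D e & V e z.
    have [Dz|nDz] := pselect (D z); first by exists z; last exact: (nV z).2.
    apply: contrapT => H; apply: nDz; apply/DP => e _ De Ve.
    by apply: H; exists e.
  elim/(well_founded_ind rho_wf): e De Ve => e IH De Ve.
  have [[d [Dd Vd de]]|H] :=
    pselect (exists d, [/\ D d, V d z & lt (rho d) (rho e)]).
    exact: IH de Dd Vd.
  by exists e; split=> // d Dd Vd de; apply: H; exists d.
exists D; have [|cD dD] := @closed_discrete_separated Y D; last first.
  split=> //; apply/seteqP; split=> // z _.
  by have [e [De Ve _]] := first_cover z; exists e.
(* Near [z]: points of [D] of rank above [e] avoid [V e], those of rank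
   below [e] avoid the up-set of [z], and those of the rank of [e] lie in one
   down-set, which [N] meets at most at [z]. *)
move=> z; have [e [De Vez emin]] := first_cover z.
have [N oN [Nz Nsub]] := sep (rho e) z.
exists (V e `&` [set y | r z y] `&` N).
  by apply: openI => //; apply: openI; [exact: (nV e).1|exact: oup].
split=> [|d [[[Ved zd] Nd] Dd]]; first by split=> //; split=> //; exact: rxx.
have [de|de|ed] := ltE (rho d) (rho e); last by case: ((DP d).1 Dd e ed De).
- (* Then [z] has a rank below that of [e], so nothing covers it earlier and it
     is selected itself, contradicting the minimality of [e]. *)
  have ze : lt (rho z) (rho e).
    have zd' : ~ lt (rho d) (rho z) := (rhoP z).2 _ (rT _ _ _ zd (rhoP d).1).
    by have [h|->//|//] := ltE (rho z) (rho d); exact: ltT h de.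
  case: (emin z _ _ ze); last exact: (nV z).2.
  by apply/DP => f fz Df Vf; apply: (emin f Df Vf); exact: ltT fz ze.
- by apply: Nsub; split=> //=; rewrite -de; exact: (rhoP d).1.
Qed.

Lemma open_set_val (X : topologicalType) (A B : set X) :
  open B -> open (set_val @^-1` B : set (set_type A)).
Proof. by move=> oB; exists B. Qed.

Lemma closed_discrete_order_hereditarily_D (Y : topologicalType)
  (r : Y -> Y -> Prop) :
  closed_discrete_order r -> hereditarily D_space Y.
Proof.
move=> [rxx rT oup sep] A.
apply: (@closed_discrete_order_D _ (fun x y : set_type A => r (val x) (val y))).
split=> [x|x y z|x|x z]; [exact: rxx|exact: rT| |].
  exact: (open_set_val A (oup (val x))).
have [N oN [Nz Nsub]] := sep (val x) (val z).
exists (set_val @^-1` N); first exact: open_set_val.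
by split=> // y [Ny yx]; apply: val_inj; exact: Nsub.
Qed.

(** * Point-finite orders on scattered spaces *)

(** Paracompactness of the subspace [\bigcup_(A in G) A], which is open, gives
    the refinement; being locally finite there, it is point-finite in [X]. *)
Lemma point_finite_refinement (X : topologicalType) (G : set (set X)) :
  hereditarily paracompact X -> G `<=` open ->
  exists V : set (set X), [/\ V `<=` open, refines V G,
    \bigcup_(A in V) A = \bigcup_(A in G) A &
    forall x, finite_set [set A | V A /\ A x]].
Proof.
move=> pX oG; pose H := \bigcup_(A in G) A.
have oH : open H by exact: bigcup_open.
have [_ pH] := pX H.
have [|W [[oW cW] rW fW]] := pH [set set_val @^-1` A | A in G].
  split=> [_ [A GA <-]|]; first by apply: open_set_val; exact: oG.
  apply/seteqP; split=> // x _; have [A GA Ax] := set_valP x.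
  by exists (set_val @^-1` A) => //; exists A.
exists [set set_val @` B | B in W]; split.
- move=> _ [B WB <-]; have [C oC CB] := oW B WB.
  rewrite (_ : _ @` _ = C `&` H); first exact: openI.
  apply/seteqP; split=> [_ [x Bx <-]|x [Cx Hx]].
    by split; [rewrite -CB in Bx|exact: set_valP].
  by exists (SigSub (mem_set Hx)) => //; rewrite -CB.
- move=> _ [B WB <-]; have [_ [A GA <-] BA] := rW B WB.
  by exists A => // _ [x Bx <-]; exact: BA.
- apply/seteqP; split=> [_ [_ [B WB <-] [x Bx <-]]|x Hx]; first exact: set_valP.
  have : [set: set_type H] (SigSub (mem_set Hx)) by [].
  rewrite -cW => -[B WB Bx]; exists (set_val @` B); first by exists B.
  by exists (SigSub (mem_set Hx)).
- move=> x; have [Hx|nHx] := pselect (H x); last first.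
    apply: (@sub_finite_set _ _ set0) => // _ [[B _ <-] [y _ yx]].
    by apply: nHx; rewrite -yx; exact: set_valP.
  have [N Nx fN] := fW (SigSub (mem_set Hx)).
  apply: sub_finite_set (finite_image (fun B => set_val @` B) fN).
  move=> _ [[B WB <-] [y By yx]]; exists B => //; split=> //.
  exists y; split=> //.
  rewrite (_ : y = SigSub (mem_set Hx)); first exact: nbhs_singleton Nx.
  exact: val_inj.
Qed.

(** A preorder on [G] is encoded as a relation on [X] that holds between points
    of [G] only, so that its up-sets are open in [X] and cover exactly [G]. *)
Definition point_finite_order (X : topologicalType) (G : set X)
    (r : X -> X -> Prop) :=
  [/\ forall x y, r x y -> G x /\ G y, forall x, G x -> r x x,
      forall x y z, r x y -> r y z -> r x z,
      forall x, open [set y | r x y] & forall y, finite_set [set x | r x y]].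

Lemma point_finite_order_open (X : topologicalType) (G : set X) r :
  point_finite_order G r -> open G.
Proof.
move=> [rG rxx _ oup _]; rewrite (_ : G = \bigcup_(x in G) [set y | r x y]).
  by apply: bigcup_open => x _; exact: oup.
by apply/seteqP; split=> [x Gx|y [x _ /rG[]//]]; exists x => //; exact: rxx.
Qed.

Lemma point_finite_order_sub (X : topologicalType) (G H : set X) r :
  point_finite_order G r -> open H -> H `<=` G ->
  point_finite_order H (fun x y => [/\ H x, H y & r x y]).
Proof.
move=> [rG rxx rT oup fdn] oH HG; split.
- by move=> x y [].
- by move=> x Hx; split=> //; apply: rxx; exact: HG.
- by move=> x y z [Hx Hy xy] [_ Hz yz]; split=> //; exact: rT yz.
- move=> x; have [Hx|nHx] := pselect (H x); last first.
    rewrite (_ : mkset _ = set0); first exact: open0.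
    by apply/seteqP; split=> // y [].
  rewrite (_ : mkset _ = H `&` [set y | r x y]); first exact: openI.
  by apply/seteqP; split=> y [].
- by move=> y; apply: sub_finite_set (fdn y) => x [].
Qed.

(** With a point-finite open refinement [V] whose members [A] carry orders
    [r A], let [x <= y] mean that [r A x y] for every [A] in [V] containing
    [x].  Up-sets are finite intersections of open sets because [V] is
    point-finite.  The order is transitive because a point [y] above [x] lies in
    every member of [V] that contains [x].  The points below [y] are
    below [y] for one of the finitely many members containing [y]. *)
Lemma point_finite_order_bigcup (X : topologicalType) (G : set (set X)) :
  hereditarily paracompact X ->
  (forall A, G A -> exists r, point_finite_order A r) ->
  exists r, point_finite_order (\bigcup_(A in G) A) r.
Proof.
move=> pX GP.
have oG : G `<=` open by move=> A /GP[r]; exact: point_finite_order_open.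
have [V [oV rV <- fV]] := point_finite_refinement pX oG.
have /choice[r rP] A : exists r, V A -> point_finite_order A r.
  have [VA|nVA] := pselect (V A); last by exists (fun _ _ => False).
  have [B /GP[r rB] AB] := rV A VA.
  by exists (fun x y => [/\ A x, A y & r x y]) => _;
    apply: point_finite_order_sub rB (oV A VA) AB.
pose R x y := (\bigcup_(A in V) A) x /\ forall A, V A -> A x -> r A x y.
exists R; split.
- move=> x y [[A VA Ax] xy]; split; exists A => //.
  by have [rA _ _ _ _] := rP A VA; have [] := rA x y (xy A VA Ax).
- by move=> x Vx; split=> // A VA Ax; have [_ rxx _ _ _] := rP A VA; exact: rxx.
- move=> x y z [Vx xy] [_ yz]; split=> // A VA Ax.
  have [rA _ rT _ _] := rP A VA.
  have rxy := xy A VA Ax; have [_ Ay] := rA _ _ rxy.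
  exact: rT rxy (yz A VA Ay).
- move=> x; have [Vx|nVx] := pselect ((\bigcup_(A in V) A) x); last first.
    rewrite (_ : mkset _ = set0); first exact: open0.
    by apply/seteqP; split=> // y [].
  rewrite (_ : mkset _ = \bigcap_(A in [set A | V A /\ A x]) [set y | r A x y]).
    rewrite -closedC setC_bigcap; apply: closed_bigcup; first exact: fV.
    by move=> A [VA _]; have [_ _ _ oup _] := rP A VA; exact/open_closedC/oup.
  apply/seteqP; split=> [y [_ xy] A [VA Ax]|y xy]; first exact: xy.
  by split=> // A VA Ax; exact: xy.
- move=> y; apply: (@sub_finite_set _ _
    (\bigcup_(A in [set A | V A /\ A y]) [set x | r A x y])).
    move=> x [[A VA Ax] xy]; exists A; last exact: xy.
    by split=> //; have [rA _ _ _ _] := rP A VA; case: (rA _ _ (xy A VA Ax)).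
  apply: bigcup_finite; first exact: fV.
  by move=> A [VA _]; have [_ _ _ _ fdn] := rP A VA; exact: fdn.
Qed.

(** Placing [p] below the whole of [G] creates one new up-set, the open set
    [p |` G], and adds one point to each down-set. *)
Lemma point_finite_order_setU1 (X : topologicalType) (G : set X) p r :
  point_finite_order G r -> open (p |` G) ->
  exists r', point_finite_order (p |` G) r'.
Proof.
move=> [rG rxx rT oup fdn] oGp.
have [Gp|nGp] := pselect (G p).
  by exists r; rewrite setUidr // => _ ->.
exists (fun x y => (x = p /\ (p |` G) y) \/ r x y); split.
- move=> x y [[-> Gy]|/rG[Gx Gy]]; first by split=> //; left.
  by split; right.
- by move=> x [->|Gx]; [left; split=> //; left|right; exact: rxx].
- move=> x y z [[-> _] [[_ Gz]|/rG[_ Gz]]|xy [[yp _]|yz]].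
  + by left.
  + by left; split=> //; right.
  + by case: nGp; rewrite -yp; case: (rG _ _ xy).
  + by right; exact: rT yz.
- move=> x; have [->|xp] := pselect (x = p).
    rewrite (_ : mkset _ = p |` G) //.
    apply/seteqP; split=> [y [[]//|/rG[_ Gy]]|y Gy].
      by right.
    by left.
  rewrite (_ : mkset _ = [set y | r x y]) //.
  by apply/seteqP; split=> [y [[]//|]|y]; last by right.
- move=> y; apply: (@sub_finite_set _ _ ([set p] `|` [set x | r x y])).
    by move=> x [[-> _]|xy]; [left|right].
  by rewrite finite_setU.
Qed.

(** If the largest orderable open set were not [X], some point would be isolated
    in its complement, and adding that point would give a larger one. *)
Lemma scattered_point_finite_order (X : topologicalType) :
  hereditarily paracompact X -> scattered X ->
  exists r, point_finite_order [set: X] r.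
Proof.
move=> pX sX; pose G := [set A : set X | exists r, point_finite_order A r].
pose H := \bigcup_(A in G) A.
have [r rH] : exists r, point_finite_order H r.
  exact: point_finite_order_bigcup.
have [/sX[p [/set_mem nHp [N Np Nsub]]]|HT] := pselect (~` H !=set0);
  last first.
  exists r; rewrite (_ : setT = H) //; apply/seteqP; split=> // x _.
  by apply: contrapT => nHx; apply: HT; exists x.
have oHp : open (p |` H).
  rewrite (_ : _ |` _ = N° `|` H); last first.
    apply/seteqP; split=> [x [->|Hx]|x [/interior_subset Nx|Hx]];
      [by left|by right| |by right].
    have [Hx|nHx] := pselect (H x); first by right.
    by left; rewrite -[[set p]]Nsub.
  by apply: openU; [exact: open_interior|exact: point_finite_order_open rH].
have [r' r'P] := point_finite_order_setU1 rH oHp.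
by case: nHp; exists (p |` H); [exists r'|left].
Qed.

(** Hausdorffness is inherited from the subspace consisting of all of [X], which
    is homeomorphic but not identical to [X]. *)
Lemma hereditarily_paracompact_accessible (X : topologicalType) :
  hereditarily paracompact X -> accessible_space X.
Proof.
move=> /(_ setT)[/hausdorff_accessible T1 _] x y /eqP xy.
have [|_ [[A oA <-] /set_mem Ax /set_mem Ay]] :=
  T1 (SigSub (mem_set (I : setT x))) (SigSub (mem_set (I : setT y))).
  by apply/eqP => /(congr1 val).
by exists A; split=> //; apply/mem_set.
Qed.

(** * Open sets of box and nabla products *)

Lemma open_open_box (X : topologicalType) (U : nat -> set X) :
  (forall n, open (U n)) ->
  open (open_box U : set (box_product X)).
Proof. by move=> oU; exists [set U]; [move=> _ ->|rewrite bigcup_set1]. Qed.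

Definition cofinitely (P : nat -> Prop) := finite_set [set n | ~ P n].

Lemma cofinitelyS (P Q : nat -> Prop) :
  (forall n, P n -> Q n) -> cofinitely P -> cofinitely Q.
Proof. by move=> PQ; apply: sub_finite_set => n /= nQ /PQ. Qed.

Lemma cofinitelyI (P Q : nat -> Prop) :
  cofinitely P -> cofinitely Q -> cofinitely (fun n => P n /\ Q n).
Proof.
move=> fP fQ.
apply: (@sub_finite_set _ _ ([set n | ~ P n] `|` [set n | ~ Q n])).
  by move=> n /= /not_andP.
by rewrite finite_setU.
Qed.

Lemma cofinitelyT (P : nat -> Prop) : (forall n, P n) -> cofinitely P.
Proof.
by move=> PT; apply: (@sub_finite_set _ _ set0) => // n /(_ (PT n)).
Qed.

Lemma eqstarP (X : topologicalType) (x y : box_product X) :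
  reflect (cofinitely (fun n => x n = y n)) (eqstar x y).
Proof. exact: asboolP. Qed.

Lemma cofinitely_repr_pi (X : topologicalType) (w : box_product X) :
  cofinitely (fun n => repr (\pi_(nabla_product X)%qT w) n = w n).
Proof. by apply/eqstarP/eqmodP; rewrite reprK. Qed.

Lemma nabla_eq (X : topologicalType) (p q : nabla_product X) :
  cofinitely (fun n => repr p n = repr q n) -> p = q.
Proof. by move=> pq; rewrite -[p]reprK -[q]reprK; exact/eqmodP/eqstarP. Qed.

(** The preimage in the box product of such a set is the union of all boxes
    that are contained in it at almost every coordinate. *)
Lemma open_nabla_box (X : topologicalType) (U : nat -> set X) :
  (forall n, open (U n)) ->
  open [set q : nabla_product X | cofinitely (fun n => U n (repr q n))].
Proof.
move=> oU; rewrite /open /= /quotient_open.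
rewrite (_ : _ @^-1` _ = \bigcup_(W in [set W : nat -> set X |
    (forall n, open (W n)) /\ cofinitely (fun n => W n `<=` U n)]) open_box W).
  by apply: bigcup_open => W [oW _]; exact: open_open_box.
apply/seteqP; split=> w /=.
  move=> /(cofinitelyI (cofinitely_repr_pi w)) Uw.
  (* The finitely many coordinates where [w] escapes [U] are left free. *)
  exists (fun n => if pselect (U n (w n)) then U n else setT).
    split=> [n|].
      by case: (pselect (U n (w n))) => h; [exact: oU|exact: openT].
    by apply: cofinitelyS Uw => n [->]; case: (pselect (U n (w n))) => h ? /=.
  by move=> n; case: (pselect (U n (w n))).
move=> [W [_ WU] Ww].
apply: cofinitelyS (cofinitelyI (cofinitely_repr_pi w) WU).
by move=> n [-> sub]; exact: sub (Ww n).
Qed.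

(** * The coordinatewise orders *)

Section Products.
Variables (X : topologicalType) (r : X -> X -> Prop).
Hypotheses (T1X : accessible_space X) (rP : point_finite_order [set: X] r).

Let rxx x : r x x. Proof. by have [_ H _ _ _] := rP; exact: H. Qed.
Let rT x y z : r x y -> r y z -> r x z.
Proof. by have [_ _ H _ _] := rP; exact: H. Qed.
Let oup x : open [set y | r x y].
Proof. by have [_ _ _ H _] := rP; exact: H. Qed.

(** The neighbourhood of [z] avoiding every other point below [x]. It is used at
    all coordinates at once to separate a point from a down-set of a product. *)
Lemma open_predecessorsD1 (x z : X) :
  open (~` ([set y | r y x] `\ z)).
Proof.
rewrite openC; apply: accessible_finite_set_closed.1 => //.
by apply: finite_setD; have [_ _ _ _ H] := rP; exact: H.
Qed.

Lemma box_closed_discrete_order :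
  @closed_discrete_order (box_product X) (fun x y => forall n, r (x n) (y n)).
Proof.
split=> [x n|x y z xy yz n|x|x z]; [exact: rxx|exact: rT (xy n) (yz n)| |].
  by apply: (@open_open_box X (fun n => [set y | r (x n) y])) => n; exact: oup.
exists (open_box (fun n => ~` ([set y | r y (x n)] `\ z n))).
  by apply: open_open_box => n; exact: open_predecessorsD1.
split=> [n /= []|y [yN yx]] //.
by apply/funext => n; apply: contrapT => yz; exact: yN n (conj (yx n) yz).
Qed.

Lemma nabla_closed_discrete_order :
  @closed_discrete_order (nabla_product X)
    (fun p q => cofinitely (fun n => r (repr p n) (repr q n))).
Proof.
split=> [p|p q s pq qs|p|p z].
- by apply: cofinitelyT => n; exact: rxx.
- by apply: cofinitelyS (cofinitelyI pq qs) => n [pqn qsn]; exact: rT pqn qsn.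
- apply: (@open_nabla_box X (fun n => [set y | r (repr p n) y])) => n.
  exact: oup.
pose U n := ~` ([set y | r y (repr p n)] `\ repr z n).
exists [set q | cofinitely (fun n => U n (repr q n))].
  by apply: open_nabla_box => n; exact: open_predecessorsD1.
split=> [|q [qU qp]]; first by apply: cofinitelyT => n; rewrite /U /= => -[_].
apply: nabla_eq; apply: cofinitelyS (cofinitelyI qU qp) => n [Un rn].
by apply: contrapT => qz; exact: Un (conj rn qz).
Qed.

End Products.

Theorem theorem19 (X : topologicalType) :
  hereditarily paracompact X -> scattered X ->
  hereditarily D_space (box_product X) /\
  hereditarily D_space (nabla_product X).
Proof.
move=> pX sX; have [r rP] := scattered_point_finite_order pX sX.
have T1X := hereditarily_paracompact_accessible pX.
split; apply: closed_discrete_order_hereditarily_D.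
- exact: box_closed_discrete_order T1X rP.
- exact: nabla_closed_discrete_order T1X rP.
Qed.
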